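(* For every Tychonoff space $X$ with $|X|>1$ and every cardinal $\kappa$ there is a cardinal $\kappa'\geq\kappa$ such that the power $X^{\kappa'}$ is not D-separable.
   Context: Tychonoff spaces are $T_1$ and completely regular; powers carry the Tychonoff product topology. A subset is discrete if it is discrete in its subspace topology. A space $Y$ is D-separable if for every sequence $(D_n:n\in\omega)$ of dense subspaces of $Y$ one can pick discrete sets $F_n\subset D_n$ so that $\bigcup_{n\in\omega}F_n$ is dense in $Y$. *)

(* Defs.v *)
From HB Require Import structures.
From mathcomp Require Import all_boot all_order all_algebra.
From mathcomp Require Import all_classical all_reals topology normedtype.

Set Implicit Arguments.
Unset Strict Implicit.
Unset Printing Implicit Defensive.

Import Order.TTheory GRing.Theory Num.Theory.
Import numFieldNormedType.Exports.

Local Open Scope classical_set_scope.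
Local Open Scope ring_scope.

Definition tychonoff_space (X : topologicalType) : Prop :=
  accessible_space X /\ completely_regular_space X.

(* [completely_regular_space] is defined in the library through uniformities;
   this is the usual form with continuous functions into the unit interval. *)
Lemma completely_regular_spaceP (R : realType) (X : topologicalType) :
  completely_regular_space X <->
  forall (a : X) (B : set X), closed B -> ~ B a ->
    exists f : X -> R, [/\ continuous f, range f `<=` `[0, 1],
      f a = 0 & forall b, B b -> f b = 1].
Proof.
split=> crX a B clB Ba; have := crX a B clB Ba.
- move/(uniform_separatorP (R := R)) => [f [cf f01 fa fB]].
  exists f; split => //; first by apply: fa; exists a.
  by move=> b Bb; apply: fB; exists b.
- move=> [f [cf f01 fa fB]]; apply/(uniform_separatorP (R := R)).
  by exists f; split => // _ [b + <-] => [->|/fB].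
Qed.

(* [set_type A] carries the topology induced by the inclusion into [Y]. *)
Definition discrete_subset (Y : topologicalType) (A : set Y) : Prop :=
  forall U : set (set_type A), open U.

Definition D_separable (Y : topologicalType) : Prop :=
  forall D : nat -> set Y, (forall n, dense (D n)) ->
    exists F : nat -> set Y,
      [/\ forall n, F n `<=` D n,
          forall n, discrete_subset (F n) &
          dense (\bigcup_n F n)].

(* Main.v *)
Require Import Defs.
From HB Require Import structures.
From mathcomp Require Import all_boot all_order all_algebra.
From mathcomp Require Import all_classical all_reals topology normedtype.
From mathcomp Require wochoice.

(**
  Let [O] be a well-order of type [c^+], with [c] the continuum, and let [P] be
  the space of countable subsets of [O], a neighbourhood of [x] being given by
  the trace of [x] on an initial segment.  In [P] discrete sets are nowhere
  dense, and countable unions of nowhere dense sets are nowhere dense.  The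
  space [P] also has a remote filter in the sense of van Douwen: each nowhere
  dense [A] has a clopen set [W A] disjoint from it, in such a way that the
  sets [W A] have the finite intersection property.

  Take a disjoint sum of copies of [P] indexed by a type [S], and use as
  coordinates all the subsets [e] of [S * P].  On its copy of [P], the index
  [s] provides a function [v] of the trace of [e] on countably many points of
  [S * P]; the point [(s, x)] yields the element of the power whose coordinate
  [e] is the value of [v] if [x] is in [W] of the slice of [e] at [s], and a
  fixed [a] otherwise.  As finitely many coordinates are told apart by finitely
  many points and the [W] sets are centered, these elements are dense.  The map
  is continuous, so a countable union of discrete sets comes from a set [e] with
  nowhere dense slices, and all its elements take the value [a] at the
  coordinate [e]: it is not dense.
*)

Set Implicit Arguments.
Unset Strict Implicit.
Unset Printing Implicit Defensive.

Local Open Scope classical_set_scope.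
Local Open Scope card_scope.

(** * A well-order of type [c^+] *)

Lemma interleave_bits (l1 l2 : nat -> bool) :
  exists l : nat -> bool,
    (forall n, l n.*2 = l1 n) /\ (forall n, l n.*2.+1 = l2 n).
Proof.
exists (fun n => if odd n then l2 n./2 else l1 n./2).
split=> n; first by rewrite odd_double doubleK.
by rewrite /= odd_double /= uphalf_double.
Qed.

(* [cs_segment] and [cs_bounded] say that proper initial segments have size at
   most [c] and that the cofinality is greater than [c]. *)
Record continuum_successor (O : Type) (lt : O -> O -> Prop) : Prop := {
  cs_inhabited : inhabited O;
  cs_irr : forall x, ~ lt x x;
  cs_trans : forall x y z, lt x y -> lt y z -> lt x z;
  cs_total : forall x y, [\/ lt x y, x = y | lt y x];
  cs_min : forall P : O -> Prop, (exists x, P x) ->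
    exists x, P x /\ forall y, P y -> ~ lt y x;
  cs_segment : forall k, exists g : (nat -> bool) -> O,
    forall x, lt x k -> exists l, g l = x;
  cs_bounded : forall f : (nat -> bool) -> O, exists k, forall l, lt (f l) k }.

(** In a well-order of the subsets of [L], take the shortest initial segment that is not an image of
    [L]. It has no cofinal family indexed by [L], since [c] many sets of size at most [c] cannot
    cover it. *)
Lemma continuum_successor_exists :
  exists (O : Type) (lt : O -> O -> Prop), continuum_successor lt.
Proof.
pose L := nat -> bool; pose U : eqType := set L.
have [R woR] := wochoice.well_ordering_principle U.
have woRin : wochoice.wo_chain R predT by move=> A _; exact: woR.
have Rtot x y : R x y \/ R y x.
  by apply/orP; exact: (wochoice.wo_chainW woRin).
have Ranti x y : R x y -> R y x -> x = y.
  move=> xy yx; apply: (wochoice.wo_chain_antisymmetric woRin) => //.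
  by rewrite xy.
have Rmin (P : U -> Prop) :
    (exists x, P x) -> exists x, P x /\ forall y, P y -> R x y.
  move=> [x Px]; have [|z [[zP zmin] _]] := woR (fun x => `[< P x >]).
    by exists x; apply/asboolP.
  by exists z; split=> [|y Py]; [exact/asboolP|apply: zmin; exact/asboolP].
have Rtrans x y z : R x y -> R y z -> R x z.
  move=> xy yz.
  have [|m [+ mmin]] := Rmin (fun u => [\/ u = x, u = y | u = z]).
    by exists x; apply: Or31.
  case=> mE; subst m.
  - by apply: mmin; exact: Or33.
  - by rewrite (Ranti _ _ xy (mmin _ _)) //; exact: Or31.
  - by rewrite -(Ranti _ _ yz (mmin _ _)) //; exact: Or32.
pose lt x y := ~ R y x.
pose small (A : U -> Prop) :=
  exists g : L -> U, forall x, A x -> exists l, g l = x.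
have [J [Jlow Jns Js]] : exists J : U -> Prop,
    [/\ forall x y, J y -> lt x y -> J x, ~ small J &
        forall k, J k -> small (lt^~ k)].
  have [[k nsk]|nk] := pselect (exists k, ~ small (lt^~ k)).
    have [|k0 [nk0 k0min]] := Rmin (fun k => ~ small (lt^~ k)).
      by exists k.
    exists (lt^~ k0); split=> // [x y yk xy|x xk].
      by move=> kx; case: (Rtot x y) => // xRy; apply: yk; exact: Rtrans xRy.
    by apply: contrapT => /k0min.
  exists (fun=> True); split=> // [|k _]; last first.
    by apply: contrapT => nsk; apply: nk; exists k.
  (* Cantor's diagonal argument. *)
  move=> [g gsurj]; have [l gl] := gsurj (fun l => ~ g l l) I.
  have : g l l <-> ~ g l l by rewrite {1}gl.
  tauto.
pose O := {x : U | J x}.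
have O0 : O.
  apply: cid; apply: contrapT => nO.
  by apply: Jns; exists (fun=> set0) => x Jx; case: nO; exists x.
exists O, (fun x y => lt (sval x) (sval y)); split; first exact: inhabits O0.
- by move=> x; apply; case: (Rtot (sval x) (sval x)).
- move=> x y z xy yz zx; have := Rtot (sval y) (sval z).
  by case=> // yRz; apply: xy; exact: Rtrans yRz zx.
- move=> x y.
  have [yx|] := pselect (R (sval y) (sval x)); last exact: Or31.
  have [xy|] := pselect (R (sval x) (sval y)); last exact: Or33.
  apply: Or32; apply: eq_sig_hprop => [? ? ?|]; last exact: Ranti.
  exact: Prop_irrelevance.
- move=> P [x Px].
  have [|z [[Jz Pz] zmin]] := Rmin (fun u => exists Ju : J u, P (exist _ u Ju)).
    by exists (sval x); case: x Px => u Ju Pu; exists Ju.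
  exists (exist _ z Jz); split=> // -[y Jy] Py; apply => /=.
  by apply: zmin; exists Jy.
- move=> [k Jk]; have [g gP] := Js k Jk.
  exists (fun l =>
    if pselect (J (g l)) is left Jg then exist _ (g l) Jg else O0).
  move=> [x Jx] /= /[dup] xk /gP [l glx]; exists l; case: pselect => /=.
    by move=> ?; apply: eq_sig_hprop => // ? ? ?; exact: Prop_irrelevance.
  by rewrite glx.
- move=> f; apply: contrapT => nk; apply: Jns.
  have /choice [g gP] : forall l, exists g : L -> U,
      forall x, R x (sval (f l)) -> exists m, g m = x.
    move=> l; have [g gP] := Js _ (svalP (f l)).
    (* Bit 0 separates the endpoint from the points strictly below it. *)
    exists (fun m => if m 0%N then g (fun n => m n.+1) else sval (f l)).
    move=> x xR; have [xk|] := pselect (lt x (sval (f l))).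
      have [m <-] := gP x xk.
      by exists (fun n => if n is n'.+1 then m n' else true).
    by move/contrapT => xR'; exists (fun=> false); exact: Ranti.
  exists (fun l => g (fun n => l n.*2) (fun n => l n.*2.+1)) => x Jx.
  have [l xl] : exists l, R x (sval (f l)).
    apply: contrapT => nl; apply: nk; exists (exist _ x Jx) => l /= xl.
    by apply: nl; exists l.
  have [m gm] := gP l x xl; have [p [p1 p2]] := interleave_bits l m.
  by exists p; rewrite -gm; congr (g _ _); apply: funext.
Qed.

(** * The space of countable subsets and its remote filter *)

Section CountableSubsets.
Context (O : Type) (lt : O -> O -> Prop) (csO : continuum_successor lt).

(* A point is a countable subset of [O], given by an enumeration; enumerations
   of the same set are indistinguishable for [agree]. *)
Let point := nat -> option O.

Definition pmem (x : point) (o : O) := exists n, x n = Some o.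

Definition agree (a : O) (x y : point) :=
  forall o, lt o a -> pmem x o <-> pmem y o.

Definition nowhere_dense (A : set point) := forall x a, exists y b,
  agree a x y /\ forall z, agree b y z -> ~ A z.

Lemma lt_asym x y : lt x y -> ~ lt y x.
Proof.
by move=> xy yx; apply: (cs_irr csO (x := x)); exact: (cs_trans csO) yx.
Qed.

Lemma lt_le_trans x y z : lt x y -> ~ lt z y -> lt x z.
Proof.
move=> xy zy; have [//|xz|zx] := cs_total csO x z; case: zy.
  by rewrite -xz.
exact: (cs_trans csO) xy.
Qed.

Lemma le_lt_trans x y z : ~ lt y x -> lt y z -> lt x z.
Proof.
move=> yx yz; have [xy|->|] := cs_total csO x y => //.
exact: (cs_trans csO) yz.
Qed.

Lemma bounded2 x y : exists k, lt x k /\ lt y k.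
Proof.
have [k kP] := cs_bounded csO (fun l => if l 0 then x else y).
by exists k; split; [exact: (kP xpredT)|exact: (kP xpred0)].
Qed.

Lemma bounded_nat (f : nat -> O) : exists k, forall n, lt (f n) k.
Proof.
have [k kP] := cs_bounded csO (fun l => f (xget 0 [set n | l n])).
exists k => n; have := kP (pred1 n).
by case: xgetP => [m _ /eqP -> //|/(_ n) []]; exact: eqxx.
Qed.

Lemma agree_sym a x y : agree a x y -> agree a y x.
Proof. by move=> xy o /xy; tauto. Qed.

Lemma agree_trans a x y z : agree a x y -> agree a y z -> agree a x z.
Proof. by move=> xy yz o oa; have := xy o oa; have := yz o oa; tauto. Qed.

Lemma agree_le a b x y : ~ lt b a -> agree b x y -> agree a x y.
Proof. by move=> ab xy o oa; apply: xy; exact: lt_le_trans ab. Qed.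

Lemma agree_lt a b x y : lt a b -> agree b x y -> agree a x y.
Proof. by move/lt_asym; exact: agree_le. Qed.

(** A fusion: the sets are avoided one after the other at increasing levels. The levels stay
    bounded, and the union of the traces is again countable. *)
Lemma nowhere_bigcup (A : nat -> set point) :
  (forall n, nowhere_dense (A n)) -> nowhere_dense (\bigcup_n A n).
Proof.
move=> nA x a.
have /choice [f fP] : forall nxa : nat * (point * O), exists yb : point * O,
    [/\ agree nxa.2.2 nxa.2.1 yb.1, lt nxa.2.2 yb.2 &
        forall z, agree yb.2 yb.1 z -> ~ A nxa.1 z].
  move=> [n [x' a']] /=; have [y [b [xy Ay]]] := nA n x' a'.
  have [k [ak bk]] := bounded2 a' b.
  by exists (y, k); split=> // z /(agree_lt bk); exact: Ay.
pose s := fix s n := if n is n'.+1 then f (n', s n') else (x, a).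
have sS n : [/\ agree (s n).2 (s n).1 (s n.+1).1, lt (s n).2 (s n.+1).2 &
    forall z, agree (s n.+1).2 (s n.+1).1 z -> ~ A n z].
  exact: (fP (n, s n)).
have smono n m :
    n <= m -> ~ lt (s m).2 (s n).2 /\ agree (s n).2 (s n).1 (s m).1.
  move/subnKC <-; elim: (m - n)%N => [|d [IHlt IHa]].
    by rewrite addn0; split=> //; exact: (cs_irr csO).
  rewrite addnS; have [h1 h2 _] := sS (n + d)%N; split.
    by move=> h; apply: IHlt; exact: (cs_trans csO) h.
  by apply: agree_trans IHa _; exact: agree_le h1.
have [b bP] := bounded_nat (fun n => (s n).2).
pose y : point := fun m => if unpickle m is Some ni then
  if (s ni.1).1 ni.2 is Some o then
    if pselect (lt o (s ni.1).2) is left _ then Some o else None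
  else None else None.
have yP o : pmem y o <-> exists n, lt o (s n).2 /\ pmem (s n).1 o.
  split=> [[m]|[n [on [i io]]]]; last first.
    by exists (pickle (n, i)); rewrite /y pickleK /= io; case: pselect.
  rewrite /y; case: unpickle => // -[n i] /=.
  case sni : ((s n).1 i) => [o'|] //.
  by case: pselect => // o'n [<-]; exists n; split=> //; exists i.
have ys n : agree (s n).2 (s n).1 y.
  move=> o on; split=> [so|]; first by apply/yP; exists n.
  move=> /yP [m [om mo]]; have [/smono [_ h]|/ltnW/smono [_ h]] := leqP n m.
    by apply/h.
  by apply/h.
exists y, b; split; first exact: (ys 0).
move=> z yz [n _]; have [_ _] := sS n; apply.
by apply: agree_trans (ys _) _; apply: agree_lt yz.
Qed.

(** This is [c^omega = c]: in the code [l], row 0 marks the positions in use and row [n.+1] names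
    the element at position [n]. *)
Lemma point_traces k : exists G : (nat -> bool) -> point,
  forall x, exists l, agree k x (G l).
Proof.
have [g gP] := cs_segment csO k.
exists (fun l n => if l (pickle (0, n)) then
  Some (g (fun m => l (pickle (n.+1, m)))) else None).
move=> x.
have /choice [h hP] : forall n, exists l,
    forall o, x n = Some o -> lt o k -> g l = o.
  move=> n; case: (x n) => [o|]; last by exists xpred0.
  have [/gP [l <-]|nok] := pselect (lt o k); first by exists l => o' [].
  by exists xpred0 => o' [<-].
exists (fun m => if unpickle m is Some ni then
  if ni.1 is n.+1 then h n ni.2 else
    `[< exists o, x ni.2 = Some o /\ lt o k >] else false) => o ok.
split=> -[n].
  move=> xo; exists n; rewrite pickleK /= ifT; last by apply/asboolP; exists o.
  congr Some; rewrite -[RHS](hP _ _ xo ok); congr g; apply: funext => m.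
  by rewrite pickleK.
rewrite pickleK /=; case: asboolP => // -[o' [xo' o'k]] [<-]; exists n.
rewrite xo'; congr Some; rewrite -[LHS](hP _ _ xo' o'k); congr g.
by apply: funext => m; rewrite pickleK.
Qed.

(** The bound [lt b k] leaves room to avoid further sets afterwards. *)
Definition closure_point (A : set point) (k : O) := forall a x, lt a k ->
  exists y b, [/\ ~ lt b a, lt b k, agree a x y &
    forall z, agree b y z -> ~ A z].

(** A level [a] has at most [c] traces, so one level [h a] serves them all; [k] is the supremum of
    the iterates of [h]. *)
Lemma closure_point_exists A o :
  nowhere_dense A -> exists k, lt o k /\ closure_point A k.
Proof.
move=> nA.
have /choice [h hP] : forall a, exists b, lt a b /\
    forall x, exists y, agree a x y /\ forall z, agree b y z -> ~ A z.
  move=> a; have [G GP] := point_traces a.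
  have /choice [e eP] : forall l, exists yb : point * O,
      agree a (G l) yb.1 /\ forall z, agree yb.2 yb.1 z -> ~ A z.
    by move=> l; have [y [b]] := nA (G l) a; exists (y, b).
  have [b bP] := cs_bounded csO (fun l => (e l).2).
  have [c [ac bc]] := bounded2 a b; exists c; split=> // x.
  have [l xl] := GP x; have [ly yA] := eP l; exists (e l).1; split.
    exact: agree_trans ly.
  by move=> z /(agree_lt bc)/(agree_lt (bP l)); exact: yA.
have [k [kP kmin]] := cs_min csO (bounded_nat (fun n => iter n h o)).
exists k; split=> [|a x ak]; first exact: (kP 0).
have [n an] : exists n, ~ lt (iter n h o) a.
  apply: contrapT => nn; apply: (kmin a) => // n.
  by apply: contrapT => na; apply: nn; exists n.
have [hlt hA] := hP (iter n h o); have [y [xy yA]] := hA x.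
exists y, (iter n.+1 h o); split=> //; last exact: agree_le xy.
by move=> ha; apply: an; exact: (cs_trans csO) ha.
Qed.

Lemma remote_filter : exists W : set point -> set point,
  [/\ forall A, nowhere_dense A -> forall x, W A x -> ~ A x,
      forall A, exists b, forall x y, agree b x y -> W A x -> W A y &
      forall s : seq (set point), exists x, forall A, A \in s -> W A x].
Proof.
have [o] := cs_inhabited csO.
have /choice [k kP] : forall A, exists k,
    lt o k /\ (nowhere_dense A -> closure_point A k).
  move=> A; have [nA|nA] := pselect (nowhere_dense A).
    by have [k [ok kA]] := closure_point_exists o nA; exists k.
  by have [k [ok _]] := bounded2 o o; exists k.
pose W A x := nowhere_dense A -> forall z, agree (k A) x z -> ~ A z.
exists W; split.
- by move=> A nA x /(_ nA); apply.
- move=> A; exists (k A) => x y xy Wx nA z yz.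
  by apply: (Wx nA); exact: agree_trans yz.
- (* In increasing order of [k], avoiding one set leaves the level reached
     below the closure points of the remaining ones. *)
  move=> s; pose leT A B := `[< ~ lt (k B) (k A) >].
  have leT_total : total leT.
    move=> A B; apply/orP; have [AB|] := pselect (lt (k B) (k A)).
      by right; apply/asboolP; exact: lt_asym.
    by left; apply/asboolP.
  have leT_trans : transitive leT.
    move=> B A C /asboolP AB /asboolP BC; apply/asboolP => CA.
    by apply: AB; apply: le_lt_trans CA.
  suff sortedP r a x : sorted leT r -> (forall A, A \in r -> lt a (k A)) ->
      exists y, agree a x y /\ forall A, A \in r -> W A y.
    have [|x [_ xP]] := sortedP _ o (fun=> None) (sort_sorted leT_total s).
      by move=> A _; have [] := kP A.
    by exists x => A As; apply: xP; rewrite mem_sort.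
  elim: r a x => [|A r IH] a x; first by move=> _ _; exists x.
  move=> Ar ak; have rA : {in r, forall B, ~ lt (k B) (k A)}.
    by move=> B Br; apply/asboolP; exact: (allP (order_path_min leT_trans Ar)).
  have [y [b [ab bA xy yA]]] : exists y b,
      [/\ ~ lt b a, lt b (k A), agree a x y &
      nowhere_dense A -> forall z, agree b y z -> ~ A z].
    have aA := ak A (mem_head _ _).
    have [nA|nA] := pselect (nowhere_dense A).
      by have [y [b [ab bA xy yA]]] := (kP A).2 nA a x aA; exists y, b.
    by exists x, a; split=> //; exact: (cs_irr csO).
  have [|z [yz zr]] := IH b y (path_sorted Ar).
    by move=> B /rA; exact: lt_le_trans.
  exists z; split; first by apply: agree_trans xy _; exact: agree_le yz.
  move=> B; rewrite inE => /predU1P [->{B}|]; last exact: zr.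
  move=> nA u zu; apply: (yA nA); apply: agree_trans yz _.
  exact: agree_lt zu.
Qed.

Lemma bounded_seq (I : eqType) (f : I -> O) a (s : seq I) :
  exists k, lt a k /\ {in s, forall i, lt (f i) k}.
Proof.
elim: s => [|i s [k [ak sk]]].
  by have [k [ak _]] := bounded2 a a; exists k.
have [m [im km]] := bounded2 (f i) k; exists m.
split; first exact: (cs_trans csO) km.
move=> j; rewrite inE => /predU1P [->//|/sk jk]; exact: (cs_trans csO) km.
Qed.

(** The space has no isolated point: a new element above [a] and above all of [x] is added to
    [x]. *)
Lemma disagreeing_point a x :
  exists y b, [/\ lt a b, agree a x y & ~ agree b x y].
Proof.
have [c cP] := bounded_nat (fun n => odflt a (x n)).
have [o [ao co]] := bounded2 a c; have [b [ob _]] := bounded2 o o.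
have xo : ~ pmem x o.
  by move=> [n xn]; have := cP n; rewrite xn => /lt_asym; apply.
exists (fun n => if n is m.+1 then x m else Some o), b; split.
- exact: (cs_trans csO) ob.
- move=> p pa; split=> [[n xn]|[[|n] xn]]; [by exists n.+1| |by exists n].
  by case: xn => op; case: (lt_asym ao); rewrite op.
- by move=> /(_ o ob) [_ xo']; apply: xo; apply: xo'; exists 0.
Qed.

End CountableSubsets.

(** * Open sets of powers and discrete subsets *)

Lemma ptws_open_finite (I : eqType) (X : topologicalType)
    (U : set {ptws I -> X}) (f : {ptws I -> X}) : open U -> U f ->
  exists s : seq I, forall g : {ptws I -> X}, {in s, g =1 f} -> U g.
Proof.
move=> oU Uf.
(* The filter generated by the finite cylinders at [f] converges to [f], the product topology being
   a supremum over the coordinates. *)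
pose F : set_system {ptws I -> X} :=
  [set A | exists s : seq I, forall g : {ptws I -> X}, {in s, g =1 f} -> A g].
have FF : Filter F.
  split; first by exists [::].
    move=> A B [s sA] [t tB]; exists (s ++ t) => g gf; split.
      by apply: sA => i si; apply: gf; rewrite mem_cat si.
    by apply: tB => i si; apply: gf; rewrite mem_cat si orbT.
  by move=> A B AB [s sA]; exists s => g /sA/AB.
suff Ff : F --> f by apply: Ff; exact: open_nbhs_nbhs.
apply/cvg_sup => i A [_ [[B oB <-] Bf BA]]; exists [:: i] => g gf.
by apply: BA; rewrite /= gf // mem_head.
Qed.

Lemma ptws_open_coord (I : eqType) (X : topologicalType) (V : set X) (i : I) :
  open V -> open [set f : {ptws I -> X} | V (f i)].
Proof. by apply: open_comp => f _; exact: (@proj_continuous I (fun=> X) i f). Qed.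

Lemma discrete_subset_isolated (Y : topologicalType) (F : set Y) (f : Y) :
  discrete_subset F -> F f ->
  exists V : set Y, [/\ open V, V f & forall g, F g -> V g -> g = f].
Proof.
move=> dF Ff; have [V oV VE] := dF [set u | set_val u = f].
have VP (u : F) : V (set_val u) <-> set_val u = f.
  by rewrite -[V _]/((set_val @^-1` V) u) VE.
exists V; split=> //; first by apply/(VP (SigSub (mem_set Ff))).
by move=> g Fg Vg; apply/(VP (SigSub (mem_set Fg))).
Qed.

(* A [Node] carries the countably many points on which a coordinate is tested
   and the value attached to each outcome; leaves make the type inhabited and
   at least as large as [K]. *)
Inductive slot (K P X : Type) : Type :=
  | Leaf of option K
  | Node of (nat -> nat -> slot K P X * P) & ((nat -> nat -> Prop) -> X).

(** * The dense family in the power *)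

Section DensePoints.
Context (K : Type) (X : topologicalType) (O : Type) (lt : O -> O -> Prop).
Context (csO : continuum_successor lt).
Let point := nat -> option O.
Context (W : set point -> set point).
Hypothesis W_disjoint :
  forall A, nowhere_dense lt A -> forall x, W A x -> ~ A x.
Hypothesis W_clopen :
  forall A, exists b, forall x y, agree lt b x y -> W A x -> W A y.
Hypothesis W_centered :
  forall s : seq (set point), exists x, forall A, A \in s -> W A x.
Context (a b : X) (V : set X).
Hypothesis (oV : open V) (Vb : V b) (nVa : ~ V a).

Let S := slot K point X.
Let coord : eqType := set (S * point).
Let slice (e : set (S * point)) (s : S) : set point := [set x | e (s, x)].

Definition slot_fun (p : S * point) : {ptws coord -> X} := fun e =>
  if p.1 is Node c v then
    if pselect (W (slice e p.1) p.2) then v (fun i j => e (c i j)) else a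
  else a.

Lemma slot_fun_dense : dense (range slot_fun).
Proof.
move=> U [f Uf] oU; have [r rU] := ptws_open_finite oU Uf.
pose x0 : point := fun=> None.
have /choice [d dP] : forall ee : coord * coord, exists p : S * point,
    (ee.1 p <-> ee.2 p) -> ee.1 = ee.2.
  move=> [e e'] /=; have [<-|ne] := pselect (e = e').
    by exists (Leaf _ _ None, x0).
  apply: contrapT => np; apply: ne; apply/funext => p; apply/propext.
  by apply: contrapT => np'; apply: np; exists p.
(* Test [(i, j)] tells entries [i] and [j] of [r] apart, so the outcomes of all tests determine an
   element of [r]. *)
pose c i j := d (nth set0 r i, nth set0 r j).
pose tr (e : coord) i j : Prop := e (c i j).
have tr_inj e e' : e \in r -> e' \in r -> tr e = tr e' -> e = e'.
  move=> er e'r tre; have := dP (e, e') => /=; apply.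
  have := congr1 (fun t => t (index e r) (index e' r)) tre.
  by rewrite /tr /c !nth_index // => ->.
(* [v] decodes the outcomes into an element of [r] and returns its value under [f]. *)
pose v t := f (xget set0 [set e | e \in r /\ tr e = t]).
pose s : S := Node c v.
have [x xP] := W_centered [seq slice e s | e <- r].
exists (slot_fun (s, x)); split; last by exists (s, x).
apply: rU => e er; rewrite /slot_fun /=.
case: pselect => [Wx|[]] /=; last by apply: xP; exact: map_f.
rewrite /v; case: xgetP => [e' _ [e'r tre]|/(_ e) []//].
by rewrite (tr_inj e' e).
Qed.

(** For fixed [s] a coordinate takes at most two values, chosen by membership in a clopen set. *)
Lemma slot_fun_locally_constant (s : S) (r : seq coord) o : exists k,
  lt o k /\ forall x y, agree lt k x y ->
    {in r, slot_fun (s, x) =1 slot_fun (s, y)}.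
Proof.
have /choice [h hP] : forall e : coord, exists k, forall x y,
    agree lt k x y -> W (slice e s) x -> W (slice e s) y.
  by move=> e; exact: W_clopen.
have [k [ok kr]] := bounded_seq csO h o r; exists k; split=> // x y xy e er.
have xy' := agree_lt csO (kr e er) xy.
rewrite /slot_fun /=; case: s hP xy' => // c v hP xy'.
case: pselect => [Wx|Wx]; case: pselect => // Wy.
  by case: Wy; exact: hP Wx.
by case: Wx; apply: hP Wy; exact: agree_sym.
Qed.

(** Isolation in [F] involves finitely many coordinates, so [z] is alone in the slice among the
    points agreeing with it up to some level [k]; a point leaving [z] beyond [k] has a neighbourhood
    missing the slice. *)
Lemma discrete_slice_nowhere_dense (F : set {ptws coord -> X}) (A : set (S * point)) s :
  discrete_subset F -> (forall p, A p -> F (slot_fun p)) ->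
  {in A &, injective slot_fun} -> nowhere_dense lt (slice A s).
Proof.
move=> dF AF Ainj x o.
have [[z [xz Az]]|nz] := pselect (exists z, agree lt o x z /\ slice A s z);
  last first.
  by exists x, o; split=> // z xz Az; apply: nz; exists z.
have [U [oU Uz Uiso]] := discrete_subset_isolated dF (AF _ Az).
have [r rU] := ptws_open_finite oU Uz.
have [k [ok kr]] := slot_fun_locally_constant s r o.
have [y [m [km zy nzy]]] := disagreeing_point csO k z.
exists y, m; split.
  by apply: agree_trans xz _; exact: (agree_lt csO) ok zy.
move=> u yu Au; apply: nzy.
suff -> : z = u by exact: agree_sym.
have zu : agree lt k z u.
  by apply: agree_trans zy _; exact: (agree_lt csO) km yu.
suff [] : (s, z) = (s, u) by [].
apply: Ainj; rewrite ?inE //; apply/esym/Uiso; first exact: AF.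
by apply: rU => e er; rewrite (kr _ _ zu).
Qed.

Lemma slot_power_not_D_separable : ~ D_separable {ptws coord -> X}.
Proof.
move=> /(_ (fun=> range slot_fun) (fun=> slot_fun_dense)) [F [FD dF Fdense]].
(* All leaves give the constant [a], so [slot_fun] is not injective; [q] selects one preimage of
   each point of the range. *)
have /choice [q qP] : forall f : {ptws coord -> X}, exists p,
    range slot_fun f -> slot_fun p = f.
  move=> f; have [[p _ <-]|nf] := pselect (range slot_fun f); first by exists p.
  by exists (Leaf _ _ None, fun=> None).
pose A n := [set p | F n (slot_fun p) /\ q (slot_fun p) = p].
have Anw n s : nowhere_dense lt (slice (A n) s).
  apply: (discrete_slice_nowhere_dense s (dF n)); first by move=> p [].
  by move=> p p'; rewrite !inE => -[_ pE] [_ p'E] pp'; rewrite -pE -p'E pp'.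
(* The diagonal step: the set of all selected preimages is itself a coordinate. *)
pose e : coord := \bigcup_n A n.
have enw s : nowhere_dense lt (slice e s).
  suff -> : slice e s = \bigcup_n slice (A n) s by exact: nowhere_bigcup.
  by apply/seteqP; split=> x [n _ ?]; exists n.
have [||f [Vf [n _ Fnf]]] := Fdense [set f : {ptws coord -> X} | V (f e)].
- by exists (fun=> b).
- exact: ptws_open_coord.
have qf : slot_fun (q f) = f by apply: qP; exact: FD Fnf.
have : e (q f) by exists n => //; split; rewrite qf.
move: Vf; rewrite /= -{1}qf; case: (q f) => s x; rewrite /slot_fun /=.
case: s => // c v; case: pselect => // Wx _ ex.
exact: (W_disjoint (enw _) Wx).
Qed.

End DensePoints.

Theorem theorem36 (X : topologicalType) (hX : tychonoff_space X)
    (hX2 : exists x y : X, x <> y) (K : Type) :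
  exists K' : Type,
    [set: K] #<= [set: K'] /\ ~ D_separable {ptws K' -> X}.
Proof.
have [a [b /eqP ab]] := hX2; have [T1 _] := hX.
have [V [oV /set_mem Va /set_mem nVb]] := T1 a b ab.
have [O [lt csO]] := continuum_successor_exists.
have [W [W_disjoint W_clopen W_centered]] := remote_filter csO.
pose point := nat -> option O; pose S := slot K point X.
exists (set (S * point)); split.
  pose j (k : K) : set (S * point) := [set p | p.1 = Leaf _ _ (Some k)].
  have j_inj : injective j.
    move=> k k' jk; have : j k (Leaf _ _ (Some k), fun=> None) by [].
    by rewrite jk => -[].
  have := inj_card_eq (in2W j_inj : {in [set: K] &, injective j}).
  rewrite card_eq_le => /andP [_ h]; apply: card_le_trans h _.
  exact: subset_card_le.
(* Here [V] contains [a] and not [b], so [b] is the default value of the coordinates. *)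
exact: (slot_power_not_D_separable csO W_disjoint W_clopen W_centered oV Va nVb).
Qed.
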